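(* Let $c>0$ and $\lambda>0$. Let $X_1,X_2,\ldots$ be independent copies of a non-negative random variable $X$, let $\theta_1,\theta_2,\ldots$ be independent copies of an exponentially distributed random variable $\theta$ with mean $\mathbb{E}\theta=1/\lambda$, and suppose the sequences $\{X_1,X_2,\ldots\}$ and $\{\theta_1,\theta_2,\ldots\}$ are mutually independent. For $u\geqslant 0$ let $$W(t)=u+ct-\sum_{i=1}^{\Theta(t)}X_i,\quad t\geqslant 0,$$ where $\Theta(t)=\#\{n\geqslant 1: \theta_1+\ldots+\theta_n\in[0,t]\}$, be the surplus process of the classical risk model, and let $\psi(u)$ be its ultimate time ruin probability. If $\lambda\,\mathbb{E}X=c$, then $\psi(u)=1$ for all $u\geqslant 0$.
   Context: For initial surplus $u\geqslant 0$ the time of ruin is $\tau_u=\inf\{t\geqslant 0: W(t)<0\}$, with $\tau_u=\infty$ if $W(t)\geqslant 0$ for all $t\geqslant 0$. The ultimate time ruin probability is $$\psi(u)=\mathbb{P}(\tau_u<\infty)=\mathbb{P}\left(\sup_{n\geqslant 1}\sum_{k=1}^n (X_k-c\,\theta_k)>u\right).$$ In the classical risk model $\Theta(t)$ is a Poisson process with intensity $\lambda$. *)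

(* Defs.v *)
From HB Require Import structures.
From mathcomp Require Export all_boot all_order all_algebra.
From mathcomp Require Export all_classical all_reals all_analysis.

Set Implicit Arguments.
Unset Strict Implicit.
Unset Printing Implicit Defensive.

Import Order.TTheory GRing.Theory Num.Theory.
Import numFieldNormedType.Exports.

Local Open Scope classical_set_scope.
Local Open Scope ring_scope.
Local Open Scope ereal_scope.

(** Sequences are indexed from 0: [X n] and [theta n] stand for
    the (n+1)-th claim X_{n+1} and inter-arrival time theta_{n+1}. *)

Section probability_notions.
Context d (T : measurableType d) (R : realType) (P : probability T R).

Definition same_law (X Y : {RV P >-> R}) : Prop :=
  forall A : set R, measurable A -> distribution P X A = distribution P Y A.

(** The rate is left unspecified; the mean is imposed separately. *)
Definition exponentially_distributed (Y : {RV P >-> R}) : Prop :=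
  exists2 rate : R, (0 < rate)%R &
    forall A : set R, measurable A ->
      distribution P Y A = exponential_prob rate A.

Definition independent_RVs (Y : nat -> {RV P >-> R}) : Prop :=
  forall (s : seq nat) (A : nat -> set R),
    uniq s -> (forall i, measurable (A i)) ->
    P (\bigcap_(i in [set` s]) (Y i @^-1` A i)) =
      \prod_(i <- s) P (Y i @^-1` A i).

Definition independent_copies (X : {RV P >-> R}) (Y : nat -> {RV P >-> R}) :
    Prop :=
  independent_RVs Y /\ forall n, same_law (Y n) X.

Definition sigma_sequence (Y : nat -> {RV P >-> R}) : set_system T :=
  <<s \bigcup_n preimage_set_system [set: T] (Y n) measurable >>.

Definition independent_sequences (Y Z : nat -> {RV P >-> R}) : Prop :=
  forall E F : set T, sigma_sequence Y E -> sigma_sequence Z F ->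
    P (E `&` F) = P E * P F.

End probability_notions.

Section surplus_process.
Context d (T : measurableType d) (R : realType).
Variables (c : R) (X theta : nat -> {mfun T >-> R}).

Definition arrival (n : nat) (w : T) : R := (\sum_(k < n) theta k w)%R.

(** [counting] is the cardinality of a set, with value [+oo] on infinite sets;
    the latter happens only on a null event for exponential [theta]. *)
Definition claim_count (t : R) (w : T) : \bar R :=
  counting [set n : nat | (0 < n)%N /\ (0 <= arrival n w <= t)%R].

(** The sum of the first [claim_count t w] claims, a series if this number is
    infinite. *)
Definition claim_total (t : R) (w : T) : \bar R :=
  \sum_(0 <= i <oo | i%:R%:E < claim_count t w) (X i w)%:E.

Definition surplus (u t : R) (w : T) : \bar R :=
  (u + c * t)%:E - claim_total t w.

(** The infimum of the empty set is [+oo]. *)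
Definition ruin_time (u : R) (w : T) : \bar R :=
  ereal_inf [set t%:E | t in [set t : R | (0 <= t)%R /\ surplus u t w < 0]].

Definition ruin_probability (P : probability T R) (u : R) : \bar R :=
  P [set w | ruin_time u w < +oo].

End surplus_process.

(* Main.v *)
Require Import Defs.
From HB Require Import structures.
From mathcomp Require Import all_boot all_order all_algebra.
From mathcomp Require Import all_classical all_reals all_analysis.
From mathcomp Require Import measurable_realfun ring lra.
From mathcomp Require finmap.

(** Ruin is almost sure because the surplus just after the n-th claim is
[u - S_n], where [S_n] is the random walk with independent identically
distributed steps [xi_k = X_k - c theta_k]; the hypothesis [lambda E X = c]
says exactly that these steps have mean zero, and a mean-zero walk whose steps
are unbounded below has [sup_n S_n = +oo] almost surely
([random_walk_unbounded]). On the almost sure event where all claims and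
inter-arrival times are nonnegative, [S_n > u] forces ruin at the n-th arrival
([ruin_at_arrival]).

The oscillation of the walk is proved from the recursion for its maximum. Let
[M] be the maximum of [0, S_1, S_2, ...] and [M'] the same maximum for the walk
driven by [xi_1, xi_2, ...]. Then [M = max(0, xi_0 + M')], [M] and [M'] have the
same law, and [xi_0] is independent of [M']. If [M'] were integrable, then
[E(M - M') = 0] while [M - M' = max(- M', xi_0) >= xi_0] and [E xi_0 = 0],
so [xi_0 >= - M'] almost surely; as [xi_0] is independent of [M'] and unbounded
below, [M'] cannot be bounded by any constant with positive probability. Since
integrability, and even finiteness, of [M'] is not available, the maxima are
first taken over [n] steps and truncated at a level [K]. The truncated
increments are dominated by [|xi_0|], their means tend to [0] as [n] grows
because the truncated maxima have bounded monotone means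
([integral_incr_cvg0]), and dominated convergence in [n] and then in [K]
gives [E(M - M'; M' < +oo) = 0] ([integral_total_incr]), which suffices
([walk_max_le_null]).

Two further ingredients are needed. Independence of functions of disjoint
blocks of variables comes from the pi-lambda theorem ([independent_blocks],
[independent_joint_blocks]). The ruin event is a union over uncountably many
times, so its measurability has to be shown: if ruin ever occurs, then it occurs
at a rational time or at an arrival time ([ruined_at_countable]). *)

Set Implicit Arguments.
Unset Strict Implicit.
Unset Printing Implicit Defensive.

Import Order.TTheory GRing.Theory Num.Theory.
Import numFieldNormedType.Exports.

Local Open Scope classical_set_scope.
Local Open Scope ring_scope.

(** * Independence of sigma-algebras *)

Section preimages.
Context d (T : measurableType d) (R : realType).
Implicit Types (U : {mfun T >-> R}) (A : set R).

Lemma measurable_preimage U A : measurable A -> measurable (U @^-1` A).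
Proof.
by move=> mA; rewrite -[X in measurable X]setTI; exact: measurable_funP.
Qed.

End preimages.

Section independence.
Context d (T : measurableType d) (R : realType) (P : probability T R).
Local Open Scope ereal_scope.

Definition independent_systems (G H : set_system T) : Prop :=
  forall A B, G A -> H B -> P (A `&` B) = P A * P B.

Lemma independent_systemsC G H :
  independent_systems G H -> independent_systems H G.
Proof. by move=> GH A B HA GB; rewrite setIC muleC GH. Qed.

(** For a fixed [A] in [G], both [B |-> P (B `&` A)] and [B |-> P A * P B] are
finite measures; they agree on the pi-system [H], hence on [<<s H >>]. *)
Lemma independent_systems_sigmar (G H : set_system T) :
  G `<=` measurable -> H `<=` measurable -> setI_closed H -> H setT ->
  independent_systems G H -> independent_systems G <<s H >>.
Proof.
move=> Gm Hm HI HT GH A B GA sHB.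
have mA : measurable A := Gm _ GA.
have PAfin : P A \is a fin_num by exact: fin_num_measure.
pose p : {nonneg R} := NngNum (fine_ge0 (measure_ge0 P A)).
rewrite setIC -[LHS]/(mrestr P mA B).
rewrite (@g_sigma_algebra_measure_unique _ _ _ H Hm (fun=> setT) _ _
  (mrestr P mA) (mscale p P)) //=.
- by rewrite /mscale/= fineK.
- by rewrite bigcup_const.
- by move=> C HC; rewrite /mrestr/mscale/= setIC GH// fineK.
- by move=> _; rewrite /mrestr setTI ltey_eq PAfin.
Qed.

Lemma independent_systems_sigma (G H : set_system T) :
  G `<=` measurable -> setI_closed G -> G setT ->
  H `<=` measurable -> setI_closed H -> H setT ->
  independent_systems G H -> independent_systems <<s G >> <<s H >>.
Proof.
move=> Gm GI GT Hm HI HT GH.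
apply: independent_systems_sigmar => //.
  by apply: smallest_sub => //; exact: sigma_algebra_measurable.
exact/independent_systemsC/independent_systems_sigmar/independent_systemsC.
Qed.

End independence.

Section cylinders.
Context d (T : measurableType d) (R : realType) (P : probability T R).
Local Open Scope ereal_scope.
Implicit Types (Y : nat -> {mfun T >-> R}) (I J : set nat).

(** The finite-dimensional events of the variables [Y i], [i] in [I]: a
pi-system generating their joint sigma-algebra. *)
Definition cylinder Y I : set_system T :=
  [set E | exists s : seq nat, exists A : nat -> set R,
    [/\ uniq s, [set` s] `<=` I, forall i, measurable (A i) &
        E = \bigcap_(i in [set` s]) Y i @^-1` A i]].

Lemma cylinder_measurable Y I : cylinder Y I `<=` measurable.
Proof.
move=> _ [s [A [us sI mA ->]]].
rewrite bigcap_seq; apply: bigsetI_measurable => i _.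
exact: measurable_preimage.
Qed.

Lemma sigma_cylinder_measurable Y I E : <<s cylinder Y I >> E -> measurable E.
Proof.
apply: smallest_sub; first exact: sigma_algebra_measurable.
exact: cylinder_measurable.
Qed.

Lemma cylinderT Y I : cylinder Y I setT.
Proof.
exists [::], (fun=> setT); split => //.
by apply/seteqP; split => // x _ i; rewrite /= in_nil.
Qed.

Lemma cylinder_setI Y I : setI_closed (cylinder Y I).
Proof.
move=> _ _ [s [A [us sI mA ->]]] [s' [B [us' sI' mB ->]]].
pose C i :=
  (if i \in s then A i else setT) `&` (if i \in s' then B i else setT).
exists (undup (s ++ s')), C; split; first exact: undup_uniq.
- by move=> i; rewrite /= mem_undup mem_cat => /orP[/sI|/sI'].
- by move=> i; apply: measurableI; case: ifP.
apply/seteqP; split => x /=.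
  by move=> [xA xB] i /= _; split; case: ifP => // ?; [exact: xA|exact: xB].
move=> xC; split => i /= is_; have /= := xC i;
  rewrite mem_undup mem_cat is_ ?orbT => /(_ isT)[]; rewrite is_//.
Qed.

Lemma preimage_cylinder Y I i B : I i -> measurable B ->
  cylinder Y I (Y i @^-1` B).
Proof.
move=> Ii mB; exists [:: i], (fun=> B); split => //.
  by move=> j; rewrite /= inE => /eqP ->.
apply/seteqP; split => x /=; first by move=> xB j /=; rewrite inE => /eqP ->.
by move=> /(_ i) /=; apply; rewrite inE.
Qed.

(** Two cylinders over disjoint index sets form together a cylinder, to which
the product rule applies. *)
Lemma independent_cylinders Y I J : independent_RVs (P := P) Y ->
  (forall i, I i -> ~ J i) ->
  independent_systems P (cylinder Y I) (cylinder Y J).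
Proof.
move=> Yind IJ _ _ [s [A [us sI mA ->]]] [s' [B [us' sJ mB ->]]].
pose C i := if i \in s then A i else B i.
have s's i : i \in s' -> i \in s = false.
  by move=> /sJ Ji; apply/negP => /sI /IJ.
have uss : uniq (s ++ s').
  by rewrite cat_uniq us us' andbT /=; apply/hasPn => i /s's ->.
have mC i : measurable (C i) by rewrite /C; case: ifP.
transitivity (P (\bigcap_(i in [set` s ++ s']) (Y i @^-1` C i))).
  congr (P _); apply/seteqP; split => x /=.
    move=> [xA xB] i /=; rewrite mem_cat /C => /orP[is_|is_].
      by rewrite is_; exact: xA.
    by rewrite s's//; exact: xB.
  move=> xC; split => i /= is_; have /= := xC i; rewrite mem_cat is_ ?orbT /C.
    by rewrite is_; apply.
  by rewrite s's//; apply.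
rewrite (Yind _ _ uss mC) big_cat /=; congr (_ * _).
  rewrite (Yind _ _ us mA); apply: eq_big_seq => i is_.
  by rewrite /C is_.
by rewrite (Yind _ _ us' mB); apply: eq_big_seq => i is_; rewrite /C s's.
Qed.

Lemma independent_blocks Y I J : independent_RVs (P := P) Y ->
  (forall i, I i -> ~ J i) ->
  independent_systems P <<s cylinder Y I >> <<s cylinder Y J >>.
Proof.
move=> Yind IJ; apply: independent_systems_sigma;
  do ?[exact: cylinder_measurable|exact: cylinder_setI|exact: cylinderT].
exact: independent_cylinders.
Qed.

Lemma sigma_cylinder_sequence Y I :
  <<s cylinder Y I >> `<=` sigma_sequence (P := P) Y.
Proof.
apply: smallest_sub; first exact: smallest_sigma_algebra.
move=> _ [s [A [us sI mA ->]]].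
rewrite bigcap_seq.
apply: (@bigsetI_measurable _ (g_sigma_algebraType _)) => i _.
apply: sub_sigma_algebra; exists i => //; exists (A i) => //.
by rewrite setTI.
Qed.

Lemma measurable_cylinder Y I i : I i ->
  measurable_fun setT (Y i : g_sigma_algebraType (cylinder Y I) -> R).
Proof.
move=> Ii _ B mB; rewrite setTI; apply: sub_sigma_algebra.
exact: preimage_cylinder.
Qed.

End cylinders.

(** * Equality in law and independence of pairs *)

Section laws.
Context d (T : measurableType d) (R : realType) (P : probability T R).
Local Open Scope ereal_scope.
Implicit Types U V : T -> R.

Definition equal_laws U U' : Prop :=
  forall A : set R, measurable A -> P (U @^-1` A) = P (U' @^-1` A).

Definition independent_pair U V : Prop :=
  forall A B : set R, measurable A -> measurable B ->
    P (U @^-1` A `&` V @^-1` B) = P (U @^-1` A) * P (V @^-1` B).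

(** The law of an independent pair is the product of its marginals, so it is
determined by them. *)
Lemma equal_laws_pair U V U' V' (f : R -> R -> R) :
  measurable_fun setT U -> measurable_fun setT V ->
  measurable_fun setT U' -> measurable_fun setT V' ->
  measurable_fun setT (fun z : R * R => f z.1 z.2) ->
  independent_pair U V -> independent_pair U' V' ->
  equal_laws U U' -> equal_laws V V' ->
  equal_laws (fun w => f (U w) (V w)) (fun w => f (U' w) (V' w)).
Proof.
move=> mU mV mU' mV' mf UV UV' UU' VV' A mA.
pose bU : {mfun T >-> R} := HB.pack U (isMeasurableFun.Build _ _ _ _ _ mU).
pose bV : {mfun T >-> R} := HB.pack V (isMeasurableFun.Build _ _ _ _ _ mV).
have joint (U1 V1 : T -> R) :
    measurable_fun setT U1 -> measurable_fun setT V1 ->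
    independent_pair U1 V1 -> equal_laws U U1 -> equal_laws V V1 ->
    forall C : set (R * R), measurable C ->
    P [set w | C (U1 w, V1 w)] =
      (distribution P bU \x distribution P bV)%E C.
  move=> mU1 mV1 ind1 UU1 VV1 C mC.
  have mW : measurable_fun setT (fun w => (U1 w, V1 w)).
    exact: measurable_fun_pair.
  pose bW : {mfun T >-> (R * R)%type} :=
    HB.pack (fun w => (U1 w, V1 w)) (isMeasurableFun.Build _ _ _ _ _ mW).
  rewrite (@product_measure_unique _ _ _ _ _ (distribution P bU)
    (distribution P bV) (distribution P bW)) //.
  move=> B B' mB mB'.
  rewrite -[LHS]/(P (U1 @^-1` B `&` V1 @^-1` B')) ind1//.
  by rewrite -UU1// -VV1.
pose C := (fun z : R * R => f z.1 z.2) @^-1` A.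
have mC : measurable C by rewrite -[C]setTI; exact: mf.
rewrite -[LHS]/(P [set w | C (U w, V w)]) -[RHS]/(P [set w | C (U' w, V' w)]).
by rewrite !joint.
Qed.

Lemma equal_laws_ge0_integral U U' (g : R -> \bar R) :
  measurable_fun setT U -> measurable_fun setT U' ->
  measurable_fun [set: R] g -> (forall x, 0 <= g x) -> equal_laws U U' ->
  \int[P]_w g (U w) = \int[P]_w g (U' w).
Proof.
move=> mU mU' mg g0 UU'.
pose bU : {mfun T >-> R} := HB.pack U (isMeasurableFun.Build _ _ _ _ _ mU).
pose bU' : {mfun T >-> R} := HB.pack U' (isMeasurableFun.Build _ _ _ _ _ mU').
rewrite -[LHS](ge0_integral_distribution bU)//.
rewrite -[RHS](ge0_integral_distribution bU')//.
by apply: eq_measure_integral => A mA _; exact: UU'.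
Qed.

Lemma equal_laws_integral U U' :
  measurable_fun setT U -> measurable_fun setT U' -> equal_laws U U' ->
  \int[P]_w (U w)%:E = \int[P]_w (U' w)%:E.
Proof.
move=> mU mU' UU'; rewrite integralE [RHS]integralE.
congr (_ - _).
- rewrite (_ : (fun w => (U w)%:E)^\+ = (fun w => EFin^\+ (U w))); last first.
    exact: funepos_comp.
  rewrite (_ : (fun w => (U' w)%:E)^\+ = (fun w => EFin^\+ (U' w))); last first.
    exact: funepos_comp.
  apply: equal_laws_ge0_integral => //.
  by apply: measurable_funepos; exact: EFin_measurable.
- rewrite (_ : (fun w => (U w)%:E)^\- = (fun w => EFin^\- (U w))); last first.
    exact: funeneg_comp.
  rewrite (_ : (fun w => (U' w)%:E)^\- = (fun w => EFin^\- (U' w))); last first.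
    exact: funeneg_comp.
  apply: equal_laws_ge0_integral => //.
  by apply: measurable_funeneg; exact: EFin_measurable.
Qed.

Lemma equal_laws_integrable U U' :
  measurable_fun setT U -> measurable_fun setT U' -> equal_laws U U' ->
  P.-integrable setT (EFin \o U) -> P.-integrable setT (EFin \o U').
Proof.
move=> mU mU' UU' /integrableP[_ iU]; apply/integrableP; split.
  exact/measurable_EFinP.
rewrite -(equal_laws_ge0_integral (g := fun x => `|x%:E|) mU mU')//.
exact: measurableT_comp.
Qed.

(** On [F] the restriction [Q] of [P] to [F] agrees with [P]; by independence the
law of [U] under [Q] is [P F] times its law under [P]. *)
Lemma ge0_integral_indep_event U F (g : R -> \bar R) :
  measurable_fun setT U -> measurable F ->
  (forall A, measurable A -> P (U @^-1` A `&` F) = P (U @^-1` A) * P F) ->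
  measurable_fun [set: R] g -> (forall x, 0 <= g x) ->
  \int[P]_(w in F) g (U w) = P F * \int[P]_w g (U w).
Proof.
move=> mU mF UF mg g0.
have mgU : measurable_fun setT (fun w => g (U w)) by exact: measurableT_comp.
have PFfin : P F \is a fin_num by exact: fin_num_measure.
pose p : {nonneg R} := NngNum (fine_ge0 (measure_ge0 P F)).
pose Q := mrestr P mF.
pose bU : {mfun T >-> R} := HB.pack U (isMeasurableFun.Build _ _ _ _ _ mU).
rewrite (eq_measure_integral Q); last first.
  by move=> A mA AF; rewrite -[RHS]/(P (A `&` F)) setIidl.
transitivity (\int[Q]_w g (U w)).
  rewrite [RHS](@ge0_negligible_integral _ _ _ _ setT (~` F))//; last 2 first.
  - exact: measurableC.
  - by rewrite -[LHS]/(P (~` F `&` F)) setICl measure0.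
  by rewrite setTD setCK.
transitivity (\int[pushforward Q bU]_y g y).
  by rewrite ge0_integral_pushforward// preimage_setT.
rewrite (eq_measure_integral (mscale p (distribution P bU))); last first.
  move=> A mA _; rewrite -[LHS]/(P (U @^-1` A `&` F)) UF// muleC.
  by rewrite -[RHS]/(_ * P (U @^-1` A)) /= fineK.
rewrite ge0_integral_mscale//= fineK//; congr (_ * _).
exact: (ge0_integral_distribution bU).
Qed.

Lemma integral_indep_event U F :
  measurable_fun setT U -> measurable F ->
  (forall A, measurable A -> P (U @^-1` A `&` F) = P (U @^-1` A) * P F) ->
  P.-integrable setT (EFin \o U) -> \int[P]_w (U w)%:E = 0 ->
  \int[P]_(w in F) (U w)%:E = 0.
Proof.
move=> mU mF UF iU.
rewrite integralE [in X in _ -> X]integralE.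
have posE : (fun w => (U w)%:E)^\+ = (fun w => EFin^\+ (U w)).
  exact: funepos_comp.
have negE : (fun w => (U w)%:E)^\- = (fun w => EFin^\- (U w)).
  exact: funeneg_comp.
rewrite posE negE => E0.
have mE := @EFin_measurable R [set: R].
rewrite (ge0_integral_indep_event mU mF UF (measurable_funepos mE))//.
rewrite (ge0_integral_indep_event mU mF UF (measurable_funeneg mE))//.
rewrite -muleBr ?E0 ?mule0//.
  exact: fin_num_measure.
rewrite -posE -negE; apply: fin_num_adde_defl.
by rewrite fin_numN; apply: integrable_fin_num => //; exact: integrable_funeneg.
Qed.

End laws.

(** * The steps of the walk *)

Section net_claims.
Context d (T : measurableType d) (R : realType) (P : probability T R).
Implicit Types (X theta : nat -> {mfun T >-> R}) (I J : set nat).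

(** The step of the walk at the [n]-th claim: the claim minus the premiums
collected since the previous one. *)
Definition net_claim (c : R) X theta (n : nat) : {mfun T >-> R} :=
  (X n \- (cst c \* theta n))%R.

(** A pi-system generating the joint sigma-algebra of the pairs
[(X i, theta i)], [i] in [I]. *)
Definition joint_system X theta I : set_system T :=
  [set C | exists A, exists B, [/\ <<s cylinder X I >> A,
    <<s cylinder theta I >> B & C = A `&` B]].

Lemma joint_system_measurable X theta I :
  joint_system X theta I `<=` measurable.
Proof.
move=> _ [A [B [sA sB ->]]]; apply: measurableI;
  apply: sigma_cylinder_measurable; eassumption.
Qed.

Lemma joint_system_setI X theta I : setI_closed (joint_system X theta I).
Proof.
move=> _ _ [A [B [sA sB ->]]] [A' [B' [sA' sB' ->]]].
exists (A `&` A'), (B `&` B'); rewrite setIACA; split => //.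
- exact: (@measurableI _ (g_sigma_algebraType (cylinder X I))).
- exact: (@measurableI _ (g_sigma_algebraType (cylinder theta I))).
Qed.

Lemma joint_systemT X theta I : joint_system X theta I setT.
Proof.
exists setT, setT; rewrite setTI; split => //;
  by apply: sub_sigma_algebra; exact: cylinderT.
Qed.

(** The probability of [(A `&` B) `&` (A' `&` B')], with [A], [A'] depending on
[X] and [B], [B'] on [theta], splits first between the two sequences, then inside
each of them. *)
Lemma independent_joint_blocks X theta I J :
  independent_RVs (P := P) X -> independent_RVs (P := P) theta ->
  independent_sequences (P := P) X theta ->
  (forall i, I i -> ~ J i) ->
  independent_systems P <<s joint_system X theta I >>
    <<s joint_system X theta J >>.
Proof.
move=> Xind thind Xth IJ; apply: independent_systems_sigma;
  do ?[exact: joint_system_measurable|exact: joint_system_setI|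
       exact: joint_systemT].
have seqI Y K L A B : <<s cylinder Y K >> A -> <<s cylinder Y L >> B ->
    sigma_sequence (P := P) Y (A `&` B).
  move=> /(@sigma_cylinder_sequence _ _ _ P) sA.
  move=> /(@sigma_cylinder_sequence _ _ _ P) sB.
  exact: (@measurableI _ (g_sigma_algebraType _)).
move=> _ _ [A [B [sA sB ->]]] [A' [B' [sA' sB' ->]]].
rewrite setIACA Xth; [|exact: seqI sA sA'|exact: seqI sB sB'].
rewrite (independent_blocks Xind IJ)// (independent_blocks thind IJ)//.
rewrite (Xth A B); [|exact: sigma_cylinder_sequence sA
  |exact: sigma_cylinder_sequence sB].
rewrite (Xth A' B'); [|exact: sigma_cylinder_sequence sA'
  |exact: sigma_cylinder_sequence sB'].
exact: muleACA.
Qed.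

Lemma net_claim_joint_system c X theta I i A : I i -> measurable A ->
  <<s joint_system X theta I >> (net_claim c X theta i @^-1` A).
Proof.
move=> Ii mA; rewrite -[_ @^-1` _]setTI.
pose G := joint_system X theta I.
have mX : measurable_fun setT (X i : g_sigma_algebraType G -> R).
  move=> _ B mB; rewrite setTI; apply: sub_sigma_algebra.
  exists (X i @^-1` B), setT; rewrite setIT; split => //.
    by apply: sub_sigma_algebra; exact: preimage_cylinder.
  by apply: sub_sigma_algebra; exact: cylinderT.
have mth : measurable_fun setT (theta i : g_sigma_algebraType G -> R).
  move=> _ B mB; rewrite setTI; apply: sub_sigma_algebra.
  exists setT, (theta i @^-1` B); rewrite setTI; split => //.
    by apply: sub_sigma_algebra; exact: cylinderT.
  by apply: sub_sigma_algebra; exact: preimage_cylinder.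
have : measurable_fun setT (net_claim c X theta i : g_sigma_algebraType G -> R).
  by apply: measurable_funB => //; exact: measurable_funM.
exact.
Qed.

Lemma independent_net_claims c X theta :
  independent_RVs (P := P) X -> independent_RVs (P := P) theta ->
  independent_sequences (P := P) X theta ->
  independent_RVs (P := P) (net_claim c X theta).
Proof.
move=> Xind thind Xth s A + mA; elim: s => [|i s IHs] /=.
  move=> _; rewrite big_nil (_ : \bigcap_(_ in _) _ = setT) ?probability_setT//.
  by apply/seteqP; split => // w _ j; rewrite /= in_nil.
move=> /andP[is_ us]; rewrite big_cons -(IHs us).
rewrite bigcap_seq big_cons -bigcap_seq.
apply: (independent_joint_blocks (I := [set i]) (J := [set` s]) Xind thind Xth).
- by move=> _ -> /=; apply/negP.
- exact: net_claim_joint_system.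
rewrite bigcap_seq big_seq.
apply: (@big_ind _ <<s joint_system X theta [set` s] >>).
- by apply: sub_sigma_algebra; exact: joint_systemT.
- exact: (@measurableI _ (g_sigma_algebraType _)).
- by move=> j js; exact: net_claim_joint_system.
Qed.

Lemma independent_pair_sequences X theta n :
  independent_sequences (P := P) X theta -> independent_pair P (X n) (theta n).
Proof.
move=> Xth A B mA mB; apply: Xth;
  by apply: (@sigma_cylinder_sequence _ _ _ P _ setT);
    apply: sub_sigma_algebra; exact: preimage_cylinder.
Qed.

Lemma equal_laws_net_claim c X theta n :
  independent_sequences (P := P) X theta ->
  equal_laws P (X n) (X 0%N) -> equal_laws P (theta n) (theta 0%N) ->
  equal_laws P (net_claim c X theta n) (net_claim c X theta 0).
Proof.
move=> Xth XX thth.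
apply: (equal_laws_pair (f := fun x t => x - c * t)) => //.
- by apply: measurable_funB => //; exact: measurable_funM.
- exact: independent_pair_sequences.
- exact: independent_pair_sequences.
Qed.

End net_claims.

(** * Partial maxima of a sequence of partial sums *)

Section partial_maximum.
Context (R : realType).
Implicit Types (x : nat -> R) (n j : nat).

(** The maximum of the sums of the first [k <= n] terms of
[x j, x j.+1, ...]. The recursion goes from the last term to the first, so that
the first term [x j] enters through one addition only. *)
Fixpoint partial_max x n j : R :=
  if n is m.+1 then Num.max 0 (x j + partial_max x m j.+1) else 0.

Lemma partial_max_ge0 x n j : 0 <= partial_max x n j.
Proof. by case: n => [//|n] /=; rewrite le_max lexx. Qed.

Lemma partial_maxS_ge x n j : partial_max x n j <= partial_max x n.+1 j.
Proof.
elim: n j => [|n IHn] j; first by rewrite partial_max_ge0.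
rewrite [leLHS]/= [leRHS]/= ge_max le_max lexx /= le_max.
by rewrite lerD2l IHn orbT.
Qed.

Lemma nondecreasing_partial_max x j :
  nondecreasing_seq (fun n => partial_max x n j).
Proof. by apply/nondecreasing_seqP => n; exact: partial_maxS_ge. Qed.

Lemma partial_max_gt x n j u : u < partial_max x n j ->
  exists k, u < \sum_(i < k) x (j + i)%N.
Proof.
elim: n j u => [|n IHn] j u /=; first by exists 0%N; rewrite big_ord0.
rewrite lt_max => /orP[u0|]; first by exists 0%N; rewrite big_ord0.
rewrite addrC -ltrBlDr => /IHn[k uk]; exists k.+1.
rewrite big_ord_recl addn0 addrC -ltrBlDr (lt_le_trans uk)//.
by apply: ler_sum => i _; rewrite /bump /= addSnnS.
Qed.

Lemma measurable_partial_max d (T : measurableType d) (f : nat -> T -> R) n j :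
  (forall i, (j <= i)%N -> measurable_fun setT (f i)) ->
  measurable_fun setT (fun w => partial_max (f ^~ w) n j).
Proof.
elim: n j => [|n IHn] j mf /=; first exact: measurable_cst.
apply: measurable_maxr; first exact: measurable_cst.
apply: measurable_funD; first exact: mf.
by apply: IHn => i /ltnW; exact: mf.
Qed.

(** The effect on the maximum, truncated at [K], of letting the walk start one
step earlier. *)
Definition truncated_increment x n K : R :=
  Num.min (partial_max x n.+1 0) K - Num.min (partial_max x n 1) K.

Lemma truncated_increment_le x n K : `|truncated_increment x n K| <= `|x 0%N|.
Proof.
rewrite /truncated_increment /=; have := partial_max_ge0 x n 1.
move: (partial_max x n 1) (x 0%N) => m a m0.
have : -`|a| <= a <= `|a| by rewrite -ler_norml.
move: `|a| => b /andP[ba ab]; rewrite ler_norml.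
have [am|am] := leP 0 (a + m).
- by have [|] := leP (a + m) K; have [|] := leP m K => *;
    apply/andP; split; lra.
- by have [|] := leP 0 K; have [|] := leP m K => *; apply/andP; split; lra.
Qed.

Lemma is_cvg_truncated_max x j K : 0 <= K ->
  cvgn (fun n => Num.min (partial_max x n j) K).
Proof.
move=> K0; apply: nondecreasing_is_cvgn.
  move=> m n mn; rewrite le_min [X in _ && X]ge_min lexx orbT andbT.
  by rewrite ge_min nondecreasing_partial_max.
by exists K => _ [n _ <-]; rewrite ge_min lexx orbT.
Qed.

Lemma is_cvg_truncated_increment x K : 0 <= K ->
  cvgn (fun n => truncated_increment x n K).
Proof.
move=> K0; apply: is_cvgB; last exact: is_cvg_truncated_max.
have /cvg_ex[l xl] := is_cvg_truncated_max (x := x) (j := 0%N) K0.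
by apply/cvg_ex; exists l; rewrite -cvg_shiftS in xl.
Qed.

(** When the maxima are unbounded, both of them eventually exceed [K]. *)
Lemma cvg_truncated_increment_unbounded x K :
  ~ (exists L, forall n, partial_max x n 1 <= L) ->
  truncated_increment x n K @[n --> \oo] --> 0.
Proof.
move=> ubd.
have large C : \forall n \near \oo, C <= partial_max x n 1.
  have [N CN] : exists N, C < partial_max x N 1.
    apply: contrapT => /forallNP h; apply: ubd; exists C => n.
    by rewrite leNgt; apply/negP/h.
  near=> n; apply: (le_trans (ltW CN)); apply: nondecreasing_partial_max.
  by near: n; exact: nbhs_infty_ge.
apply: cvg_near_cst; near=> n.
have h1 : K <= partial_max x n 1 by near: n; exact: large.
have h2 : K - x 0%N <= partial_max x n 1 by near: n; exact: large.
rewrite /truncated_increment /= (min_idPr _) ?(min_idPr h1) ?subrr//.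
by rewrite le_max; apply/orP; right; lra.
Unshelve. all: by end_near. Qed.

(** The effect on the untruncated maximum, since
[max(0, a + m) - m = max(- m, a)]. *)
Definition limit_increment x : R :=
  limn (fun n => Num.max (- partial_max x n 1) (x 0%N)).

Lemma is_cvg_limit_increment x :
  cvgn (fun n => Num.max (- partial_max x n 1) (x 0%N)).
Proof.
apply: nonincreasing_is_cvgn; last first.
  by exists (x 0%N) => _ [n _ <-]; rewrite le_max lexx orbT.
move=> m n mn; rewrite ge_max !le_max lexx orbT andbT lerN2.
by rewrite nondecreasing_partial_max.
Qed.

Lemma limit_increment_ge x : x 0%N <= limit_increment x.
Proof.
apply: limr_ge; first exact: is_cvg_limit_increment.
by apply: nearW => n; rewrite le_max lexx orbT.
Qed.

Lemma limit_increment_geN x L :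
  (forall n, partial_max x n 1 <= L) -> - L <= limit_increment x.
Proof.
move=> ML; apply: limr_ge; first exact: is_cvg_limit_increment.
by apply: nearW => n; rewrite le_max lerN2 ML.
Qed.

(** Truncating above [L + |x 0|], which bounds both maxima, has no effect. *)
Lemma cvg_truncated_increment_bounded x K L :
  (forall n, partial_max x n 1 <= L) -> L + `|x 0%N| <= K ->
  truncated_increment x n K @[n --> \oo] --> limit_increment x.
Proof.
move=> ML LK.
rewrite (_ : (fun n => truncated_increment x n K) =
    (fun n => Num.max (- partial_max x n 1) (x 0%N))).
  exact: is_cvg_limit_increment.
apply/funext => n; rewrite /truncated_increment /=.
have := ML n; have := partial_max_ge0 x n 1.
have := ler_norm (x 0%N); have := normr_ge0 (x 0%N); move: `|x 0%N| LK.
move: (partial_max x n 1) (x 0%N) => m a b LK b0 ab m0 mL.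
have -> : Num.min m K = m by apply/min_idPl; lra.
have -> : Num.min (Num.max 0 (a + m)) K = Num.max 0 (a + m).
  by apply/min_idPl; rewrite ge_max; apply/andP; split; lra.
by rewrite addr_maxl; congr (Num.max _ _); lra.
Qed.

End partial_maximum.

(** * Mean-zero random walks are unbounded above *)

Section oscillation.
Context d (T : measurableType d) (R : realType) (P : probability T R).
Variable xi : nat -> {mfun T >-> R}.
Hypothesis xi_indep : independent_RVs (P := P) xi.
Hypothesis xi_law : forall n, equal_laws P (xi n) (xi 0%N).
Hypothesis xi_int : P.-integrable setT (EFin \o xi 0%N).
Hypothesis xi_mean : (\int[P]_w (xi 0%N w)%:E = 0)%E.
Hypothesis xi_unbounded : forall L : R, P [set w | xi 0%N w <= L] != 0%E.

Let walk_max n j w := partial_max (xi ^~ w) n j.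
Let incr K n w := truncated_increment (xi ^~ w) n K.
Let bounded_max := [set w | exists L, forall n, walk_max n 1 w <= L].

Lemma measurable_walk_max n j : measurable_fun setT (walk_max n j).
Proof. by apply: measurable_partial_max => i _; exact: measurable_funP. Qed.

Lemma sigma_walk_max n j A : measurable A ->
  <<s cylinder xi [set i | (j <= i)%N] >> (walk_max n j @^-1` A).
Proof.
have := @measurable_partial_max R _ (g_sigma_algebraType
  (cylinder xi [set i | (j <= i)%N])) xi n j.
move=> + mA => /(_ _ measurableT A mA); rewrite setTI; apply => i ji.
exact: measurable_cylinder.
Qed.

Lemma independent_walk_max n j : independent_pair P (xi j) (walk_max n j.+1).
Proof.
move=> A B mA mB; apply: (independent_blocks xi_indep
    (I := [set j]) (J := [set i | (j < i)%N])).
- by move=> _ -> /=; rewrite ltnn.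
- by apply: sub_sigma_algebra; exact: preimage_cylinder.
- exact: sigma_walk_max.
Qed.

(** By induction: the law of [walk_max n.+1 j] is determined by those of the
independent variables [xi j] and [walk_max n j.+1]. *)
Lemma equal_laws_walk_max n j k :
  equal_laws P (walk_max n j) (walk_max n k).
Proof.
elim: n j k => [//|n IHn] j k.
apply: (equal_laws_pair (f := fun x y => Num.max 0 (x + y))) => //.
- exact: measurable_walk_max.
- exact: measurable_walk_max.
- apply: measurable_maxr; first exact: measurable_cst.
  exact: measurable_funD.
- exact: independent_walk_max.
- exact: independent_walk_max.
- by move=> A mA; rewrite !(xi_law _ mA).
- exact: IHn.
Qed.

Lemma measurable_incr K n : measurable_fun setT (incr K n).
Proof.
by apply: measurable_funB; apply: measurable_minr;
  solve [exact: measurable_cst | exact: measurable_walk_max].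
Qed.

(** By equality in law the integral is the difference of two consecutive terms
of a bounded monotone sequence. *)
Lemma integral_incr_cvg0 K : 0 <= K ->
  (\int[P]_w (incr K n w)%:E @[n --> \oo] --> 0)%E.
Proof.
move=> K0.
pose e j n := (\int[P]_w (Num.min (walk_max n j w) K)%:E)%E.
have mmin j n : measurable_fun setT (fun w => Num.min (walk_max n j w) K).
  by apply: measurable_minr; [exact: measurable_walk_max|exact: measurable_cst].
have min_ge0 j n w : 0 <= Num.min (walk_max n j w) K.
  by rewrite le_min K0 partial_max_ge0.
have imin j n :
    P.-integrable setT (EFin \o (fun w => Num.min (walk_max n j w) K)).
  apply: (@le_integrable _ _ _ _ _ measurableT _ (cst K%:E)).
  - exact/measurable_EFinP.
  - move=> w _ /=; rewrite lee_fin !ger0_norm//.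
    by rewrite ge_min lexx orbT.
  - exact: finite_measure_integrable_cst.
(* the outer maximum with 0 makes the integrand a nonnegative function on the
   whole line *)
have e10 n : e 1%N n = e 0%N n.
  have maxE j : e j n =
      (\int[P]_w (Num.max 0 (Num.min (walk_max n j w) K))%:E)%E.
    by apply: eq_integral => w _; rewrite (max_idPr (min_ge0 j n w)).
  rewrite !maxE; apply: (equal_laws_ge0_integral
    (g := fun x => (Num.max 0 (Num.min x K))%:E)).
  - exact: measurable_walk_max.
  - exact: measurable_walk_max.
  - apply/measurable_EFinP; apply: measurable_maxr; first exact: measurable_cst.
    by apply: measurable_minr; [exact: measurable_id|exact: measurable_cst].
  - by move=> x; rewrite lee_fin le_max lexx.
  - exact: equal_laws_walk_max.
have incrE n : (\int[P]_w (incr K n w)%:E = e 0%N n.+1 - e 0%N n)%E.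
  rewrite -(e10 n).
  rewrite -[RHS](integralB_EFin measurableT (imin 0%N n.+1) (imin 1%N n)).
  by apply: eq_integral => w _; rewrite /incr /truncated_increment EFinB.
have efin j n : e j n \is a fin_num.
  exact: (integrable_fin_num measurableT (imin j n)).
have [l el] : exists l : R, e 0%N n @[n --> \oo] --> l%:E.
  pose a n := fine (e 0%N n).
  have aK n : a n <= K.
    rewrite -lee_fin fineK// -[K%:E]mule1 -(probability_setT P).
    rewrite -integral_cst//; apply: (le_integral measurableT (imin 0%N n)).
      exact: finite_measure_integrable_cst.
    by move=> w _; rewrite lee_fin ge_min lexx orbT.
  have nda : nondecreasing_seq a.
    apply/nondecreasing_seqP => n; rewrite -lee_fin !fineK//.
    apply: (le_integral measurableT (imin 0%N n) (imin 0%N n.+1)) => w _.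
    by rewrite lee_fin le_min !ge_min lexx orbT andbT partial_maxS_ge.
  have /cvg_ex[l al] : cvgn a.
    by apply: nondecreasing_is_cvgn => //; exists K => _ [n _ <-].
  exists l; apply: cvg_EFin => //; exact: nearW.
rewrite (_ : (fun n => _) = (fun n => e 0%N n.+1 - e 0%N n)%E); last first.
  by apply/funext => n; exact: incrE.
rewrite -(subee (x := l%:E))//; apply: cvgeB => //.
by rewrite (cvg_shiftS (e 0%N)).
Qed.

Let limit_incr K w := limn (fun n => incr K n w).

Lemma integral_limit_incr K : 0 <= K ->
  measurable_fun setT (limit_incr K) /\
  (\int[P]_w (limit_incr K w)%:E = 0)%E.
Proof.
move=> K0.
have mlim : measurable_fun setT (limit_incr K).
  apply: (measurable_fun_cvg (h := fun n => incr K n)) => //.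
    by move=> n; exact: measurable_incr.
  by move=> w _; exact: is_cvg_truncated_increment.
split=> //.
have [] := @dominated_convergence _ _ _ P setT measurableT
  (fun n w => (incr K n w)%:E) (fun w => (limit_incr K w)%:E)
  (fun w => `|(xi 0%N w)%:E|%E).
- by move=> n; apply/measurable_EFinP; exact: measurable_incr.
- exact/measurable_EFinP.
- apply: aeW => w _; apply: cvg_EFin; first exact: nearW.
  exact: is_cvg_truncated_increment.
- exact: integrable_abse.
- by apply: aeW => w n _; rewrite lee_fin truncated_increment_le.
move=> _ _ /cvg_lim <-//.
by apply: cvg_lim => //; exact: integral_incr_cvg0.
Qed.


Lemma limit_incr_le K w : 0 <= K -> `|limit_incr K w| <= `|xi 0%N w|.
Proof.
move=> K0; have cincr := is_cvg_truncated_increment (x := xi ^~ w) K0.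
have incr_le n : `|incr K n w| <= `|xi 0%N w| by exact: truncated_increment_le.
rewrite ler_norml; apply/andP; split.
  apply: limr_ge => //; apply: nearW => n.
  by have := incr_le n; rewrite ler_norml => /andP[].
apply: limr_le => //; apply: nearW => n.
by have := incr_le n; rewrite ler_norml => /andP[].
Qed.

(** The increment of the untruncated maximum, set to [0] where the maximum is
infinite: truncation makes the increments vanish there in the limit. *)
Let total_incr w :=
  if w \in bounded_max then limit_increment (xi ^~ w) else 0.

Lemma cvg_limit_incr w : limit_incr k%:R w @[k --> \oo] --> total_incr w.
Proof.
apply: cvg_near_cst; rewrite /total_incr; case: ifPn => [|/negP].
  rewrite inE => -[L ML]; near=> k.
  apply: cvg_lim => //; apply: cvg_truncated_increment_bounded ML _.
  by near: k; exact: nbhs_infty_ger.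
rewrite inE => ubd; near=> k; apply: cvg_lim => //.
exact: cvg_truncated_increment_unbounded.
Unshelve. all: by end_near. Qed.

Lemma integral_total_incr :
  P.-integrable setT (EFin \o total_incr) /\
  (\int[P]_w (total_incr w)%:E = 0)%E.
Proof.
have mtot : measurable_fun setT total_incr.
  apply: (measurable_fun_cvg (h := fun k => limit_incr k%:R)).
    by move=> k; have [] := @integral_limit_incr k%:R (ler0n _ _).
  by move=> w _; exact: cvg_limit_incr.
have [] := @dominated_convergence _ _ _ P setT measurableT
  (fun k w => (limit_incr k%:R w)%:E) (fun w => (total_incr w)%:E)
  (fun w => `|(xi 0%N w)%:E|%E).
- move=> k; apply/measurable_EFinP.
  by have [] := @integral_limit_incr k%:R (ler0n _ _).
- exact/measurable_EFinP.
- apply: aeW => w _; apply: cvg_EFin; first exact: nearW.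
  exact: cvg_limit_incr.
- exact: integrable_abse.
- by apply: aeW => w k _; rewrite lee_fin limit_incr_le.
move=> itot _ /cvg_lim <-//; split=> //.
apply: cvg_lim => //; apply: cvg_near_cst; apply: nearW => k.
by have [] := @integral_limit_incr k%:R (ler0n _ _).
Qed.

Lemma sigma_walk_max_le L :
  <<s cylinder xi [set i | (0 < i)%N] >>
    [set w | forall n, walk_max n 1 w <= L].
Proof.
rewrite (_ : mkset _ = \bigcap_n walk_max n 1 @^-1` `]-oo, L]); last first.
  by apply/seteqP; split => [w h n _|w h n];
    [rewrite /= in_itv; exact: h|have := h n; rewrite /= in_itv; exact].
apply: (@bigcapT_measurable _ (g_sigma_algebraType _)) => n.
by apply: sigma_walk_max; exact: measurable_itv.
Qed.

Lemma bounded_maxE :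
  bounded_max = \bigcup_k [set w | forall n, walk_max n 1 w <= k%:R].
Proof.
apply/seteqP; split => [w [L ML]|w [k _ Mk]]; last by exists k%:R.
have [k Lk] : exists k : nat, L <= k%:R.
  by exists (Num.truncn L).+1; exact/ltW/truncnS_gt.
by exists k => // n; exact: le_trans Lk.
Qed.

Lemma sigma_bounded_max :
  <<s cylinder xi [set i | (0 < i)%N] >> bounded_max.
Proof.
rewrite bounded_maxE.
apply: (@bigcupT_measurable _ (g_sigma_algebraType _)) => k.
exact: sigma_walk_max_le.
Qed.

Lemma independent_of_first A E : measurable A ->
  <<s cylinder xi [set i | (0 < i)%N] >> E ->
  P (xi 0%N @^-1` A `&` E) = (P (xi 0%N @^-1` A) * P E)%E.
Proof.
move=> mA sE; apply: (independent_blocks xi_indep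
    (I := [set 0%N]) (J := [set i | (0 < i)%N])) => //.
  by move=> _ -> /=; rewrite ltnn.
by apply: sub_sigma_algebra; exact: preimage_cylinder.
Qed.

(** Subtracting from [total_incr] the step [xi 0] on [bounded_max] leaves a
nonnegative function of integral zero, which is at least [1] where the maximum is
at most [L] and [xi 0] at most [- L - 1]. These two events are independent, their
intersection is null and the second has positive probability, so the first one is
null. *)
Lemma walk_max_le_null L : P [set w | forall n, walk_max n 1 w <= L] = 0%E.
Proof.
set B := [set w | _].
have sB : <<s cylinder xi [set i | (0 < i)%N] >> B by exact: sigma_walk_max_le.
pose A := `]-oo, (- L - 1)]%classic : set R.
have mA : measurable A by exact: measurable_itv.
have mxA : measurable (xi 0%N @^-1` A) by exact: measurable_preimage.
have mB := sigma_cylinder_measurable sB.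
have mF := sigma_cylinder_measurable sigma_bounded_max.
have [itot tot0] := integral_total_incr.
have xiF0 : (\int[P]_(w in bounded_max) (xi 0%N w)%:E = 0)%E.
  apply: integral_indep_event => // C mC.
  by rewrite independent_of_first//; exact: sigma_bounded_max.
suff : P (xi 0%N @^-1` A `&` B) = 0%E.
  rewrite independent_of_first// => /eqP; rewrite mule_eq0 => /orP[|/eqP//].
  rewrite (_ : _ @^-1` _ = [set w | xi 0%N w <= - L - 1]).
    by rewrite (negbTE (xi_unbounded _)).
  by apply/seteqP; split => w; rewrite /A /= in_itv.
apply/eqP; rewrite eq_le measure_ge0 andbT.
have iF : P.-integrable setT ((EFin \o xi 0%N) \_ bounded_max).
  by apply/integrable_restrict => //; rewrite setTI; exact: integrableS xi_int.
apply: (@le_trans _ _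
  (\int[P]_w ((total_incr w)%:E - ((EFin \o xi 0%N) \_ bounded_max) w))%E).
  rewrite -(setIT (_ `&` B)) -integral_indic//; last exact: measurableI.
  apply: ge0_le_integral => //.
  - by apply/measurable_EFinP; apply: measurable_indic; exact: measurableI.
  - by apply: emeasurable_funB;
      [exact: measurable_int itot|exact: measurable_int iF].
  move=> w _; rewrite indicE /total_incr patchE.
  have [|wAB] := boolP (w \in _).
    rewrite inE => -[xA Bw].
    have xL : xi 0%N w <= - L - 1 by move: xA; rewrite /A /= in_itv.
    rewrite mem_set; last by exists L.
    rewrite -EFinB lee_fin; have := limit_increment_geN Bw.
    by rewrite /=; lra.
  case: ifPn => _ /=; last by rewrite sube0.
  by rewrite -EFinB lee_fin subr_ge0 limit_increment_ge.
rewrite integralB// tot0 sub0e -integral_mkcond.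
by rewrite xiF0 oppe0.
Qed.

(** The walk dominates [xi 0] plus the walk driven by [xi 1, xi 2, ...], so
boundedness of the former implies that of the latter. *)
Lemma random_walk_unbounded :
  {ae P, forall w, forall u, exists n, u < \sum_(k < n) xi k w}.
Proof.
exists bounded_max; split.
- exact: (sigma_cylinder_measurable sigma_bounded_max).
- apply: measure_negligible.
    exact: (sigma_cylinder_measurable sigma_bounded_max).
  rewrite bounded_maxE; apply: negligible_bigcup => k.
  apply/negligibleP; last exact: walk_max_le_null.
  exact: (sigma_cylinder_measurable (sigma_walk_max_le _)).
move=> w /= nosup; apply: contrapT => ubd; apply: nosup => u.
have [n Mn] : exists n, u < walk_max n 0 w.
  apply: contrapT => /forallNP Mu; apply: ubd; exists (u - xi 0%N w) => n.
  rewrite lerBrDl; apply: le_trans (_ : walk_max n.+1 0 w <= _).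
    by rewrite /walk_max /= le_max lexx orbT.
  by rewrite leNgt; apply/negP/Mu.
have [k uk] := partial_max_gt Mn; exists k.
exact: uk.
Qed.

End oscillation.

(** * Measurability of the ruin event *)

Section measurability.
Context d (T : measurableType d) (R : realType).
Local Open Scope ereal_scope.

Lemma is_cvgn_limn_esup (u : (\bar R)^nat) :
  cvgn u <-> limn_esup u <= limn_einf u.
Proof.
split=> [cu|supinf].
  by rewrite is_cvg_limn_esupE// is_cvg_limn_einfE.
apply/cvg_ex; exists (limn_esup u).
apply: (@squeeze_cvge _ _ _ _ (einfs u) _ (esups u)).
- apply: nearW => n; apply/andP; split.
    by apply: ereal_inf_lbound; exists n => /=.
  by apply: ereal_sup_ubound; exists n => /=.
- rewrite (_ : limn_esup u = limn (einfs u)); first exact: is_cvg_einfs.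
  rewrite -limn_einf_lim; apply/eqP; rewrite eq_le supinf /=.
  exact: limn_einf_sup.
- rewrite limn_esup_lim; exact: is_cvg_esups.
Qed.

(** Without any convergence hypothesis: [limn] is the upper limit on the
measurable set where the upper and lower limits coincide, and a constant
elsewhere. *)
Lemma measurable_limn (f : nat -> T -> \bar R) :
  (forall n, measurable_fun setT (f n)) ->
  measurable_fun setT (fun w => limn (f ^~ w)).
Proof.
move=> mf.
have msup := measurable_fun_limn_esup mf.
have minf : measurable_fun setT (fun w => limn_einf (f ^~ w)).
  apply: measurableT_comp => //.
  by apply: (@measurable_fun_limn_esup _ _ _ _ (fun n w => - f n w)) => n;
    exact: measurableT_comp.
rewrite (_ : (fun w => limn (f ^~ w)) = (fun w =>
    if limn_esup (f ^~ w) <= limn_einf (f ^~ w) then limn_esup (f ^~ w)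
    else point)).
  apply: measurable_fun_ifT => //; first exact: measurable_fun_lee.
apply/funext => w; case: ifPn => [/is_cvgn_limn_esup|/negP ncvg].
  by move/is_cvg_limn_esupE.
by apply: dvgP => /is_cvgn_limn_esup.
Qed.

Lemma countingE (S : set nat) :
  counting S = \sum_(k <oo) (\1_S k)%:E :> \bar R.
Proof.
have {1}-> : S = \bigcup_(k in S) [set k] by rewrite bigcup_imset1 image_id.
rewrite measure_bigcup//; last first.
  by apply/trivIsetP => i j _ _ ij; apply/disjoints_subset => _ -> /= /eqP;
    apply/negP.
rewrite eseries_mkcond; apply: eq_eseriesr => k _.
rewrite indicE; case: ifP => // _.
rewrite -[LHS]/(@counting nat R [set k]) /counting asboolT//.
by rewrite fset_set1 finmap.cardfs1.
Qed.

Lemma measurable_counting (S : T -> set nat) :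
  (forall n, measurable [set w | S w n]) ->
  measurable_fun setT (fun w => counting (S w) : \bar R).
Proof.
move=> mS.
rewrite (_ : (fun w => _) = (fun w => \sum_(k <oo | k \in predT)
    (\1_[set w | S w k] w)%:E)); last first.
  apply/funext => w; rewrite countingE; apply: eq_eseriesr => k _.
  by rewrite !indicE.
apply: ge0_emeasurable_sum => [k w _ _|k _]; first by rewrite lee_fin.
exact/measurable_EFinP/measurable_indic.
Qed.

End measurability.

Section ruin_event.
Context d (T : measurableType d) (R : realType).
Variables (c : R) (X theta : nat -> {mfun T >-> R}) (u : R).

Definition ruined_at (t : R) (w : T) : Prop :=
  0 <= t /\ (surplus c X theta u t w < 0)%E.

Lemma measurable_arrival n : measurable_fun setT (arrival theta n).
Proof. by apply: measurable_sum. Qed.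

Lemma measurable_ruined_at (tau : T -> R) : measurable_fun setT tau ->
  measurable [set w | ruined_at (tau w) w].
Proof.
move=> mtau.
have mcount : measurable_fun setT (fun w => claim_count theta (tau w) w).
  apply: measurable_counting => n.
  rewrite (_ : mkset _ = if (0 < n)%N then
      ([set: T] `&` [set w | 0 <= arrival theta n w]) `&`
      ([set: T] `&` [set w | arrival theta n w <= tau w])
      else set0); last first.
    apply/seteqP; split => w /=; case: ifP => [n0|n0 []//] //=.
      by move=> [_ /andP[]].
    by move=> [[_ ?] [_ ?]]; split => //; apply/andP.
  case: ifP => // _; apply: measurableI; apply: measurable_fun_le => //;
    exact: measurable_arrival.
have mtotal : measurable_fun setT (fun w => claim_total X theta (tau w) w).
  apply: measurable_limn => n.
  under eq_fun do rewrite big_mkcond.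
  apply: emeasurable_sum => i; apply: measurable_fun_ifT.
  - by apply: measurable_fun_lte.
  - by apply/measurable_EFinP.
  - exact: measurable_cst.
rewrite (_ : mkset _ = ([set: T] `&` [set w | 0 <= tau w]) `&`
    ([set: T] `&` [set w | (surplus c X theta u (tau w) w < 0)%E])); last first.
  by rewrite !setTI.
apply: measurableI; first exact: measurable_fun_le.
apply: emeasurable_fun_infty_o => //; apply: emeasurable_funB => //.
apply/measurable_EFinP; apply: measurable_funD => //.
exact: measurable_funM.
Qed.

Lemma eq_claim_total s t w :
  claim_count theta s w = claim_count theta t w ->
  claim_total X theta s w = claim_total X theta t w.
Proof. by rewrite /claim_total => ->. Qed.

(** If finitely many arrivals precede [t], then moving back to the last one
leaves the claims unchanged and reduces the premiums. If there are infinitely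
many, then the claims are the same at all later times, and by strictness ruin
persists at a slightly later rational time. Arrivals may accumulate just after
[t], so rational times alone would not do. *)
Lemma ruined_at_countable t w : 0 < c -> ruined_at t w ->
  (exists q : rat, ruined_at (ratr q) w) \/
  (exists m, ruined_at (arrival theta m w) w).
Proof.
move=> c0 [t0 ruin_t].
pose S s := [set n : nat | (0 < n)%N /\ 0 <= arrival theta n w <= s].
have surE s : surplus c X theta u s w =
    ((u + c * s)%:E - claim_total X theta s w)%E by [].
have [/finite_seqP[s St]|Sinf] := pselect (finite_set (S t)).
- right.
  (* index 0, of arrival time 0, serves when nothing has arrived by time t *)
  have [m ms mmax] : exists2 m, m \in 0%N :: s &
      forall n, n \in s -> arrival theta n w <= arrival theta m w.
    elim: (s) => [|n s' [m ms mmax]]; first by exists 0%N.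
    have [mn|nm] := leP (arrival theta m w) (arrival theta n w).
      exists n; first by rewrite !inE eqxx orbT.
      move=> k; rewrite inE => /predU1P[->//|/mmax km].
      exact: le_trans km mn.
    exists m; first by move: ms; rewrite !inE => /orP[->//|->]; rewrite !orbT.
    by move=> k; rewrite inE => /predU1P[->|/mmax//]; exact: ltW.
  exists m; set r := arrival theta m w.
  have /andP[r0 rt] : 0 <= r <= t.
    move: ms; rewrite inE => /predU1P[m0|ms].
      by rewrite /r m0 /arrival big_ord0 lexx.
    by have : S t m by [rewrite St]; case.
  have Sr : S r = S t.
    apply/seteqP; split => n [n0 /andP[an ant]]; split => //; rewrite an /=.
      exact: le_trans ant rt.
    apply: mmax; have : S t n by split => //; rewrite an.
    by rewrite St.
  split => //; apply: le_lt_trans ruin_t.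
  rewrite !surE (@eq_claim_total r t w).
    by apply: leeB => //; rewrite lee_fin lerD2l ler_pM2l.
  by rewrite /claim_count -/(S r) Sr.
- left.
  have total_eq r : t <= r -> claim_total X theta r w = claim_total X theta t w.
    move=> tr; apply: eq_claim_total.
    rewrite /claim_count /counting !asboolF//.
    apply: contra_not Sinf; apply: sub_finite_set => n [n0 /andP[an ant]].
    by split => //; rewrite an (le_trans ant).
  move: ruin_t; rewrite surE sube_lt0// => ruin_t.
  have [r tr ruin_r] : exists2 r, t < r &
      ((u + c * r)%:E < claim_total X theta t w)%E.
    case: (claim_total X theta t w) ruin_t => [z| |] //.
      rewrite lte_fin => uz; exists (t + (z - (u + c * t)) / (2 * c)).
        by rewrite ltrDl divr_gt0 ?mulr_gt0// subr_gt0.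
      rewrite lte_fin (_ : c * (_ + _) = c * t + (z - (u + c * t)) / 2).
        by lra.
      by field; rewrite gt_eqF.
    by move=> _; exists (t + 1); rewrite ?ltrDl ?ltry.
  have [q] := rat_in_itvoo tr; rewrite in_itv /= => /andP[tq qr]; exists q.
  split; first exact: le_trans t0 (ltW tq).
  rewrite surE sube_lt0// total_eq ?ltW//; apply: lt_trans ruin_r.
  by rewrite lte_fin ltrD2l ltr_pM2l.
Qed.

Lemma ruin_time_ltyE w :
  (ruin_time c X theta u w < +oo)%E <-> exists t, ruined_at t w.
Proof.
split=> [/ereal_inf_lt[_ [t rt <-] _]|[t rt]]; first by exists t.
apply: (@le_lt_trans _ _ t%:E); last exact: ltry.
by apply: ereal_inf_lbound; exists t.
Qed.

Lemma measurable_ruin : 0 < c ->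
  measurable [set w | (ruin_time c X theta u w < +oo)%E].
Proof.
move=> c0.
rewrite (_ : mkset _ = \bigcup_(q : rat) [set w | ruined_at (ratr q) w] `|`
    \bigcup_m [set w | ruined_at (arrival theta m w) w]); last first.
  apply/seteqP; split => w /=.
    move=> /ruin_time_ltyE[t /(ruined_at_countable c0)[[q rq]|[m rm]]].
      by left; exists q.
    by right; exists m.
  by move=> [[q _ rq]|[m _ rm]]; apply/ruin_time_ltyE; eexists; eassumption.
apply: measurableU; last first.
  apply: bigcupT_measurable => m; apply: measurable_ruined_at.
  exact: measurable_arrival.
apply: countable_bigcupT_measurable => [|q]; first exact: countableP.
exact: measurable_ruined_at.
Qed.

Lemma claim_count_arrival n w : (forall k, 0 <= theta k w) ->
  (n%:R%:E <= claim_count theta (arrival theta n w) w)%E.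
Proof.
move=> th0; rewrite /claim_count countingE.
have nd m : (m <= n)%N -> 0 <= arrival theta m w <= arrival theta n w.
  move=> mn; rewrite /arrival sumr_ge0//=.
  by rewrite -(subnKC mn) big_split_ord /= lerDl sumr_ge0.
apply: le_trans (nneseries_lim_ge n.+1 _); last by move=> *; rewrite lee_fin.
rewrite big_mkord big_ord_recl /= -[n in leLHS]card_ord -sum1_card natr_sum.
rewrite -sumEFin; apply: le_trans (_ : \sum_(i < n) 1%:E <= _)%E; first by [].
rewrite -[leLHS]add0e leeD ?lee_fin//.
rewrite lee_sum// => i _; rewrite lee_fin indicE mem_set//=.
by split => //; apply: nd; rewrite /bump /= add1n.
Qed.

(** At the [n]-th arrival the counted claims include the first [n]; there are
more of them when several claims arrive at the same time, which can only increase
the total. *)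
Lemma ruin_at_arrival n w : 0 <= c -> (forall k, 0 <= theta k w) ->
  (forall k, 0 <= X k w) ->
  u < \sum_(k < n) (X k w - c * theta k w) ->
  (ruin_time c X theta u w < +oo)%E.
Proof.
move=> c0 th0 X0 un; apply/ruin_time_ltyE; exists (arrival theta n w); split.
  exact: sumr_ge0.
rewrite /surplus sube_lt0//.
apply: lt_le_trans (_ : (\sum_(k < n) X k w)%:E <= _)%E.
  by rewrite lte_fin /arrival mulr_sumr -ltrBrDr -sumrB.
apply: le_trans (nneseries_lim_ge n _); last by move=> *; rewrite lee_fin.
rewrite big_mkord -sumEFin big_mkcond /= [leRHS]big_mkcond /=.
apply: lee_sum => i _; rewrite ifT//.
by apply: lt_le_trans (claim_count_arrival n th0); rewrite lte_fin ltr_nat.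
Qed.

End ruin_event.

(** * Almost sure ruin *)

Section positivity.
Context d (T : measurableType d) (R : realType) (P : probability T R).
Local Open Scope ereal_scope.

Lemma ae_ge0_of_law (U : {mfun T >-> R}) (V : T -> R) : equal_laws P U V ->
  P (V @^-1` `]-oo, 0%R[) = 0 -> {ae P, forall w, (0 <= U w)%R}.
Proof.
move=> UV V0; exists (U @^-1` `]-oo, 0%R[); split.
- exact: measurable_preimage.
- by rewrite UV.
by move=> w /= /negP; rewrite -ltNge in_itv.
Qed.

Lemma exists_le_probability (U : {mfun T >-> R}) :
  exists a : R, P [set w | (U w <= a)%R] != 0.
Proof.
apply: contrapT => /forallNP U0.
suff : P setT = 0 by rewrite probability_setT => /eqP; rewrite onee_eq0.
have mU k : measurable [set w | (U w <= k%:R)%R].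
  rewrite (_ : mkset _ = U @^-1` `]-oo, k%:R]).
    exact: measurable_preimage.
  by apply/seteqP; split => w /=; rewrite in_itv.
apply: measure_negligible => //.
rewrite (_ : setT = \bigcup_k [set w | (U w <= k%:R)%R]).
  apply: negligible_bigcup => k; apply/negligibleP => //.
  by have /negP := U0 k%:R; rewrite negbK => /eqP.
apply/seteqP; split => // w _; exists (Num.truncn (U w)).+1 => //=.
exact/ltW/truncnS_gt.
Qed.

Lemma exponential_lt0 (U : {RV P >-> R}) : exponentially_distributed U ->
  P (U @^-1` `]-oo, 0%R[) = 0.
Proof.
move=> [rate rate0 expU].
have /= := expU `]-oo, 0%R[%classic (measurable_itv _).
rewrite /distribution /pushforward => ->; rewrite /exponential_prob.
apply: integral0_eq => x /=; rewrite in_itv /= => x0.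
by rewrite lt0_exponential_pdf.
Qed.

(** The events [U < 0] and [U > t] cover the complement of [0 <= U <= s] for
[s = max t 1], which has probability [exp (- rate * s) > 0]. *)
Lemma exponential_tail (U : {RV P >-> R}) (t : R) :
  exponentially_distributed U -> P (U @^-1` `]t, +oo[) != 0.
Proof.
move=> expU; have U0 := exponential_lt0 expU.
have [rate rate0 Ulaw] := expU.
pose s := Num.max t 1%R; have s0 : (0 < s)%R by rewrite lt_max ltr01 orbT.
have m0s : measurable (U @^-1` `[0%R, s]) by exact: measurable_preimage.
have P0s : P (U @^-1` `[0%R, s]) = 1 - (expR (- rate * s))%:E.
  have /= := Ulaw `[0%R, s]%classic (measurable_itv _).
  by rewrite exponential_prob_itv0c.
apply/eqP => Ut0.
have : P (~` (U @^-1` `[0%R, s])) = 0.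
  apply: measure_negligible; first exact: measurableC.
  apply: (@negligibleS _ _ _ _ (U @^-1` `]-oo, 0%R[ `|` U @^-1` `]t, +oo[)).
    move=> w /= /negP; rewrite !in_itv /= andbT negb_and -!ltNge.
    move=> /orP[|sU]; first by left.
    by right; rewrite (le_lt_trans _ sU)// le_max lexx.
  by apply: negligibleU; apply/negligibleP => //; exact: measurable_preimage.
rewrite probability_setC// P0s.
rewrite -[1 - (1 - _)]/((1 - (1 - expR (- rate * s)))%R%:E) => /eqP.
rewrite eqe.
by rewrite opprB addrC subrK gt_eqF// expR_gt0.
Qed.

End positivity.

Theorem theorem2 (d : measure_display) (T : measurableType d) (R : realType)
    (P : probability T R) (c lambda : R)
    (X theta : {RV P >-> R}) (X_ theta_ : nat -> {RV P >-> R})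
    (c_gt0 : 0 < c) (lambda_gt0 : 0 < lambda)
    (X_ge0 : forall w : T, 0 <= X w)
    (X_copies : independent_copies X X_)
    (theta_exp : exponentially_distributed theta)
    (theta_mean : ('E_P[theta] = (1 / lambda)%:E)%E)
    (theta_copies : independent_copies theta theta_)
    (X_theta_indep : independent_sequences X_ theta_)
    (EX : (lambda%:E * 'E_P[X] = c%:E)%E) :
  forall u : R, 0 <= u -> ruin_probability c X_ theta_ P u = 1%E.
Proof.
move=> u _; have [Xind Xlaw] := X_copies; have [thind thlaw] := theta_copies.
have XX n : equal_laws P (X_ n) X by exact: Xlaw.
have thth n : equal_laws P (theta_ n) theta by exact: thlaw.
have X_int : P.-integrable setT (EFin \o X).
  apply/integrableP; split; first exact/measurable_EFinP.
  rewrite (eq_integral (EFin \o X)); last first.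
    by move=> w _; rewrite /= ger0_norm.
  rewrite -expectation_def; move: EX; case: ('E_P[X])%E => [x _| |//].
    by rewrite ltry.
  by rewrite gt0_muley ?lte_fin.
have theta_ge0 := ae_ge0_of_law (fun A _ => erefl) (exponential_lt0 theta_exp).
have theta_int : P.-integrable setT (EFin \o theta).
  apply/integrableP; split; first exact/measurable_EFinP.
  rewrite (@ae_eq_integral _ _ _ _ _ (EFin \o theta))//.
  - by rewrite -expectation_def theta_mean ltry.
  - by apply: measurableT_comp => //; exact/measurable_EFinP.
  - exact/measurable_EFinP.
  - by apply: filterS theta_ge0 => w th0 _; rewrite /= ger0_norm.
have X0_int : P.-integrable setT (EFin \o X_ 0%N).
  by apply: equal_laws_integrable X_int => // A mA; rewrite XX.
have th0_int : P.-integrable setT (EFin \o theta_ 0%N).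
  by apply: equal_laws_integrable theta_int => // A mA; rewrite thth.
pose xi := net_claim c X_ theta_.
have xi_int : P.-integrable setT (EFin \o xi 0%N).
  exact: (integrableB measurableT X0_int (integrableZl measurableT c th0_int)).
have xi_mean : (\int[P]_w (xi 0%N w)%:E = 0)%E.
  under eq_integral do rewrite /= EFinB EFinM.
  rewrite integralB//; last exact: integrableZl.
  rewrite integralZl//.
  rewrite (equal_laws_integral _ _ (XX 0%N))//.
  rewrite (equal_laws_integral _ _ (thth 0%N))//.
  rewrite -!expectation_def theta_mean; move: EX.
  have := integrable_fin_num measurableT X_int; rewrite -expectation_def.
  case: ('E_P[X])%E => // x _ [lx]; rewrite -EFinM -EFinB -lx.
  by congr (_%:E); field; rewrite gt_eqF.
(* a bounded claim after a long enough waiting time *)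
have xi_unbounded L : P [set w | xi 0%N w <= L] != 0%E.
  have [a Pa] := exists_le_probability P (X_ 0%N).
  pose t := (a - L) / c.
  have Pt : P (theta_ 0%N @^-1` `]t, +oo[) != 0%E.
    by rewrite thth//; exact: exponential_tail.
  have Xa : [set w | X_ 0%N w <= a] = X_ 0%N @^-1` `]-oo, a].
    by apply/seteqP; split => w /=; rewrite in_itv.
  have mxi : measurable [set w | xi 0%N w <= L].
    rewrite (_ : mkset _ = xi 0%N @^-1` `]-oo, L]).
      exact: measurable_preimage.
    by apply/seteqP; split => w /=; rewrite in_itv.
  apply/negP => /eqP /(proj2 (negligibleP _ mxi)) xiL.
  have : P (X_ 0%N @^-1` `]-oo, a] `&` theta_ 0%N @^-1` `]t, +oo[) = 0%E.
    apply: measure_negligible.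
      by apply: measurableI; exact: measurable_preimage.
    apply: negligibleS xiL => w /=; rewrite !in_itv /= andbT => -[wa].
    rewrite /t ltr_pdivrMr// mulrC => wt; rewrite /xi /=.
    by rewrite lerBlDr -lerBlDl; apply: le_trans (ltW wt); rewrite lerB.
  rewrite (independent_pair_sequences _ X_theta_indep)// -Xa => /eqP.
  by rewrite mule_eq0 (negbTE Pa) (negbTE Pt).
have xi_law n : equal_laws P (xi n) (xi 0%N).
  by apply: equal_laws_net_claim => // A mA; rewrite ?XX ?thth.
have unbounded := random_walk_unbounded
  (independent_net_claims c Xind thind X_theta_indep)
  xi_law xi_int xi_mean xi_unbounded.
have X_ge0' : {ae P, forall w, forall k, 0 <= X_ k w}.
  apply: ae_foralln => k; apply: (ae_ge0_of_law (XX k)).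
  rewrite (_ : _ @^-1` _ = set0) ?measure0//.
  by apply/seteqP; split => // w /=; rewrite in_itv /= ltNge X_ge0.
have theta_ge0' : {ae P, forall w, forall k, 0 <= theta_ k w}.
  apply: ae_foralln => k; apply: (ae_ge0_of_law (thth k)).
  exact: exponential_lt0.
rewrite /ruin_probability; set E := [set w | _].
have mE : measurable E by exact: measurable_ruin.
have : P (~` E) = 0%E.
  apply: measure_negligible; first exact: measurableC.
  apply: filterS3 unbounded X_ge0' theta_ge0' => w /(_ u)[n un] X0 th0.
  exact: ruin_at_arrival (ltW c_gt0) th0 X0 un.
rewrite probability_setC// => /eqP; rewrite sube_eq ?fin_num_measure//.
by rewrite add0e => /eqP.
Qed.
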